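(* Let $(V,\{\,,\,,\,\},\langle\,,\,\rangle,(\,,\,))$ be a finite dimensional $3D$-fluid algebra with curl operator $D$ and transport $T$. Let $X(t)\in V$ satisfy the Euler equation of the fluid algebra, i.e. $\left(\frac{dX(t)}{dt},W\right)=\{X(t),DX(t),W\}$ for all $W\in V$, on a time interval. If $Z(t)\in V$ is a time dependent field on the same interval whose vorticity $DZ(t)$ satisfies $\frac{d}{dt}(DZ(t))=T(X(t),DZ(t))$, then the linking number of $DZ(t)$ and $DX(t)$, i.e. the value $\langle X(t),Z(t)\rangle$, stays constant in $t$.
   Context: A finite dimensional $3D$-fluid algebra is a finite dimensional real vector space $V$ with three structures: (1) an alternating trilinear form $\{\,,\,,\,\}$ on $V$ (triple intersection form); (2) a symmetric nondegenerate bilinear form $\langle\,,\,\rangle$ on $V$ (vorticity linking form); (3) a positive definite inner product $(\,,\,)$ on $V$ (metric). The curl operator $D:V\to V$ is the linear operator defined by $(DX,Y)=\langle X,Y\rangle$ for all $X,Y\in V$. The vorticity of $X\in V$ is $DX$. The infinitesimal transport of $Z$ by $X$ is the element $T(X,Z)\in V$ defined by $(T(X,Z),W)=\{X,Z,DW\}$ for all $W\in V$. The linking number of $DZ$ and $DX$ refers to the value $\langle X,Z\rangle$. *)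

(* Defs.v *)
From HB Require Import structures.
From mathcomp Require Import all_boot all_order all_algebra.
From mathcomp Require Import all_classical all_reals all_analysis.

Set Implicit Arguments.
Unset Strict Implicit.
Unset Printing Implicit Defensive.
Import Order.TTheory GRing.Theory Num.Theory.
Import numFieldNormedType.Exports.
Local Open Scope classical_set_scope.
Local Open Scope ring_scope.

Definition trilinear (R : realType) (V : vectType R) (f : V -> V -> V -> R) :=
  [/\ forall Y Z, scalar (fun X => f X Y Z),
      forall X Z, scalar (fun Y => f X Y Z)
    & forall X Y, scalar (fun Z => f X Y Z)].

Definition alternating3 (R : realType) (V : vectType R)
    (f : V -> V -> V -> R) :=
  forall X Y, [/\ f X X Y = 0, f X Y X = 0 & f Y X X = 0].

(* [vectType R] is the structure of finite-dimensional real vector spaces, of  *)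
(* arbitrary dimension (0 included).                                           *)
Record fluid_algebra (R : realType) (V : vectType R) := FluidAlgebra {
  triple : V -> V -> V -> R;
  linking : {symmetric V};
  metric : {dot V for idfun};
  triple_trilinear : trilinear triple;
  triple_alternating : alternating3 triple;
  linking_nondegenerate : nondegenerate linking
}.

Section FluidAlgebra.
Variables (R : realType) (V : vectType R) (A : fluid_algebra V).

(* The element v with (v, W) = phi W for all W; by [rieszP] and [riesz_unique] *)
(* it exists and is unique when phi is linear.                                 *)
Definition riesz (phi : V -> R) : V :=
  xget 0 [set v | forall W, metric A v W = phi W].

Definition curl (X : V) : V := riesz (linking A X).

Definition transport (X Z : V) : V :=
  riesz (fun W => triple A X Z (curl W)).

Definition metric_norm (v : V) : R := Num.sqrt (metric A v v).

(* The derivative is taken along I: it is two-sided at interior points of I    *)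
(* and one-sided at the endpoints that belong to I. The limit is taken in the  *)
(* norm of the metric; all norms on V are equivalent.                          *)
Definition has_derivative (I : interval R) (X : R -> V) (t : R) (v : V) :=
  metric_norm ((s - t)^-1 *: (X s - X t) - v)
    @[s --> within [set` I] t^'] --> (0 : R).

Definition euler_solution (I : interval R) (X : R -> V) :=
  forall t, t \in I -> exists2 v : V, has_derivative I X t v &
    forall W, metric A v W = triple A (X t) (curl (X t)) W.

Lemma riesz_unique (u v : V) :
  (forall W, metric A u W = metric A v W) -> u = v.
Proof.
move=> uv; apply/eqP; rewrite -subr_eq0; apply/negPn/negP => d0.
have := @neq0_dnorm_gt0 _ _ _ (metric A) _ d0.
have e : metric A (u - v) (u - v) = 0.
  by rewrite linearBl; apply/eqP; rewrite subr_eq0; apply/eqP; exact: uv.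
by rewrite e ltxx.
Qed.

Lemma rieszP (phi : V -> R) :
  scalar phi -> forall W, metric A (riesz phi) W = phi W.
Proof.
move=> phiL.
suff [v hv] : exists v, forall W, metric A v W = phi W.
  by apply: (@xgetPex _ 0 [set v | forall W, metric A v W = phi W]); exists v.
pose g (v : V) : 'Hom(V, R^o) := linfun (metric A v : V -> R^o).
have gE v W : g v W = metric A v W.
  rewrite /g; exact: (lfunE (GRing.Linear.clone _ _ _ _ (metric A v : V -> R^o) _)).
have gL : linear g.
  move=> a u v; apply/lfunP => W.
  by rewrite add_lfunE scale_lfunE !gE linearPl.
pose gl := GRing.isLinear.Build _ _ _ _ g gL.
pose G : {linear V -> 'Hom(V, R^o)} := HB.pack g gl.
have kG : lker (linfun G) == 0%VS.
  apply/lker0P => u v; rewrite !lfunE => /lfunP uv.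
  by apply: riesz_unique => W; rewrite -!gE; exact: uv.
have fullG : limg (linfun G) = fullv.
  apply/eqP; rewrite eqEdim subvf /= limg_dim_eq; last by rewrite (eqP kG) capv0.
  by rewrite !dimvf /dim /= muln1.
pose pl := GRing.isLinear.Build _ _ _ _ (phi : V -> R^o) phiL.
pose P : {linear V -> R^o} := HB.pack (phi : V -> R^o) pl.
have /memv_imgP[v _ Pv] : linfun P \in limg (linfun G) by rewrite fullG memvf.
exists v => W; rewrite -gE.
by have := congr1 (fun f : 'Hom(V, R^o) => f W) Pv; rewrite !lfunE.
Qed.

Lemma curlP (X Y : V) : metric A (curl X) Y = linking A X Y.
Proof. by apply: rieszP => a u v; rewrite linearPr. Qed.

Lemma curl_is_linear : linear curl.
Proof.
move=> a X Y; apply: riesz_unique => W.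
rewrite curlP linearPl /=; apply/esym.
by rewrite [LHS]linearPl /= !curlP.
Qed.

Lemma transportP (X Z W : V) :
  metric A (transport X Z) W = triple A X Z (curl W).
Proof.
rewrite /transport rieszP // => a u v.
by rewrite curl_is_linear; have [_ _ ->] := triple_trilinear A.
Qed.

End FluidAlgebra.

(* Main.v *)
Require Import Defs.
From mathcomp Require Import all_boot all_order all_algebra.
From mathcomp Require Import all_classical all_reals all_analysis.
From mathcomp Require Import ring.

(* By symmetry of the linking form, <X, Z> = (DZ, X). The product rule for the *)
(* metric gives the derivative (T(X, DZ), X) + (DZ, X'), which the transport   *)
(* and Euler equations turn into {X, DZ, DX} + {X, DX, DZ} = 0. The derivative *)
(* is taken along an interval, one-sided at its endpoints, so the mean value   *)
(* theorem is applied on the segment between the two given times.              *)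

Import Order.TTheory GRing.Theory Num.Theory.
Import numFieldNormedType.Exports.
Local Open Scope classical_set_scope.
Local Open Scope ring_scope.

(** The linking form is traded for the metric pairing of [curl A (Z u)] with [X u] because only
    those two curves have known derivatives; [Z] itself is not assumed differentiable.
    [has_derivative_metric] differentiates this pairing, [triple_antisym] cancels the two resulting
    terms, and [within_derive0_cst] passes from a zero derivative along [I] to constancy. *)

Section Metric.
Context {R : realType} {V : vectType R} (A : fluid_algebra V).

Lemma metricC (u v : V) : metric A u v = metric A v u.
Proof. by rewrite hermC /= expr0 mul1r. Qed.

Lemma metric_ge0 (u : V) : 0 <= metric A u u.
Proof.
have [->|u0] := eqVneq u 0; first by rewrite linear0l.
exact/ltW/neq0_dnorm_gt0.
Qed.

Lemma metric_norm_CauchySchwarz (u v : V) :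
  `|metric A u v| <= metric_norm A u * metric_norm A v.
Proof.
rewrite /metric_norm -sqrtrM ?metric_ge0// -sqrtr_sqr ler_wsqrtr//.
have [->|v0] := eqVneq v 0; first by rewrite linear0r expr0n mulr_ge0 ?metric_ge0.
have vv : 0 < metric A v v by exact: neq0_dnorm_gt0.
have := metric_ge0 (metric A v v *: u - metric A u v *: v).
rewrite !(linearBl, linearBr, linearZl_LR, linearZr_LR) /= (metricC v u).
set uu := metric A u u; set p := metric A v v; set q := metric A u v => h.
rewrite -subr_ge0 -(pmulr_rge0 _ vv); apply: le_trans h _.
by rewrite le_eqVlt; apply/orP; left; apply/eqP; rewrite /GRing.scale /= -/p; ring.
Qed.

(** Joint continuity of the metric, for limits taken in [metric_norm]: expand the pairing bilinearly
    around [(a, b)] and bound each of the three error terms by Cauchy-Schwarz. *)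
Lemma cvg_metric (T : Type) (F : set_system T) (FF : Filter F)
    (f g : T -> V) (a b : V) :
  metric_norm A (f x - a) @[x --> F] --> (0 : R) ->
  metric_norm A (g x - b) @[x --> F] --> (0 : R) ->
  metric A (f x) (g x) @[x --> F] --> metric A a b.
Proof.
move=> fa gb; apply/subr_cvg0; apply: norm_cvg0.
pose na (x : T) : R := metric_norm A (f x - a).
pose nb (x : T) : R := metric_norm A (g x - b).
apply: (@squeeze_cvgr _ F FF R (cst 0) (fun x => na x * nb x +
    metric_norm A a * nb x + na x * metric_norm A b)).
- apply: nearW => x; rewrite normr_ge0 /=.
  have -> : metric A (f x) (g x) - metric A a b =
      metric A (f x - a) (g x - b) + metric A a (g x - b) + metric A (f x - a) b.
    by rewrite !linearBl !linearBr; ring.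
  apply: le_trans (ler_normD _ _) _; apply: lerD (metric_norm_CauchySchwarz _ _).
  by apply: le_trans (ler_normD _ _) _; apply: lerD; exact: metric_norm_CauchySchwarz.
- exact: cvg_cst.
- rewrite [X in _ --> X](_ : 0 = 0 * 0 + metric_norm A a * 0 + 0 * metric_norm A b);
    last by ring.
  apply: cvgD; first apply: cvgD; apply: cvgM => //; exact: cvg_cst.
Qed.

Lemma has_derivative_metric (I : interval R) (X Y : R -> V) (t : R) (v w : V) :
  has_derivative A I X t v -> has_derivative A I Y t w ->
  (s - t)^-1 * (metric A (X s) (Y s) - metric A (X t) (Y t))
    @[s --> within [set` I] t^'] --> metric A v (Y t) + metric A (X t) w.
Proof.
move=> Xv Yw; pose q (Z : R -> V) s := (s - t)^-1 *: (Z s - Z t).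
have c0 (u : V) : metric_norm A (u - u) @[s --> within [set` I] t^'] --> (0 : R).
  by rewrite subrr /metric_norm linear0l sqrtr0; exact: cvg_cst.
(* With q the difference quotient, the quotient of (X, Y) at s is              *)
(* (qX, Y t) + (X t, qY) + (s - t) (qX, qY), which avoids continuity of X, Y.  *)
have -> : metric A v (Y t) + metric A (X t) w =
    metric A v (Y t) + metric A (X t) w + 0 * metric A v w by ring.
have t0 : (s - t) @[s --> within [set` I] t^'] --> (0 : R).
  rewrite -(subrr t); apply: cvgB; last exact: cvg_cst.
  by apply: cvg_within_filter; exact: nbhs_dnbhs.
have : metric A (q X s) (Y t) + metric A (X t) (q Y s)
      + (s - t) * metric A (q X s) (q Y s) @[s --> within [set` I] t^'] -->
    metric A v (Y t) + metric A (X t) w + 0 * metric A v w.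
  by apply: cvgD; [apply: cvgD | apply: cvgM => //]; exact: cvg_metric.
apply: cvg_trans; apply: near_eq_cvg.
apply: (@cvg_within _ (t^') _ [set` I]); near=> s.
have st : s - t != 0 by rewrite subr_eq0; near: s; exact: nbhs_dnbhs_neq.
rewrite /q !(linearBl, linearBr, linearZl_LR, linearZr_LR) /= /GRing.scale /=.
by field.
Unshelve. all: by end_near. Qed.

(** Polarisation: expand the vanishing value at [X, Y + Z, Y + Z]. *)
Lemma triple_antisym (X Y Z : V) : triple A X Y Z = - triple A X Z Y.
Proof.
have [_ L2 L3] := triple_trilinear A.
have [_ _ YZ0] := triple_alternating A (Y + Z) X.
have [_ _ Y0] := triple_alternating A Y X.
have [_ _ Z0] := triple_alternating A Z X.
have D2 W : triple A X (Y + Z) W = triple A X Y W + triple A X Z W.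
  by have := L2 X W 1 Y Z; rewrite scale1r /= mul1r.
have D3 W : triple A X W (Y + Z) = triple A X W Y + triple A X W Z.
  by have := L3 X W 1 Y Z; rewrite scale1r /= mul1r.
by move: YZ0; rewrite D2 !D3 Y0 Z0 add0r addr0 => /eqP; rewrite addr_eq0 => /eqP.
Qed.

End Metric.

(** The mean value theorem on [[s, t]] asks for a two-sided derivative only inside the segment and
    for continuity up to its ends, so one-sided quotients at endpoints of [I] suffice. *)
Lemma within_derive0_cst (R : realType) (I : interval R) (f : R -> R) :
  (forall t, t \in I -> (s - t)^-1 * (f s - f t)
     @[s --> within [set` I] t^'] --> (0 : R)) ->
  forall s t, s \in I -> t \in I -> f s = f t.
Proof.
move=> f0 s t; wlog st : s t / s < t.
  move=> h; have [/h//|ts sI tI|->//] := ltgtP s t; exact/esym/h.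
move=> sI tI.
have subI u : u \in `[s, t] -> u \in I.
  by rewrite in_itv /=; exact: (interval_is_interval sI tI).
have df x : x \in `]s, t[ -> is_derive x 1 f 0.
  (* Since [x] is interior to [I], restricting to [I] does not change its punctured
     neighbourhoods. *)
  move=> xst; have Ix : \forall u \near x^', u \in I.
    apply: nbhs_dnbhs; near=> u; apply/subI/subset_itv_oo_cc.
    by near: u; exact: near_in_itvoo.
  have qx : (u - x)^-1 * (f u - f x) @[u --> x^'] --> (0 : R).
    apply: cvg_trans (f0 x (subI _ (subset_itv_oo_cc xst))).
    by apply: cvg_app => P IP; apply: filterS2 Ix IP => u uI; exact.
  (* The quotient in the form used by [is_derive], obtained by substituting [u = h + x]. *)
  have qh : h^-1 *: ((f \o shift x) (h *: 1) - f x) @[h --> 0^'] --> (0 : R).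
    have sh : (h *: (1 : R) + x) @[h --> (0 : R)^'] --> x^'.
      have sx : (h *: (1 : R) + x) @[h --> (0 : R)] --> x.
        have : (fun h : R => h * 1 + x) @ (0 : R) --> 0 * 1 + x.
          exact: (cvgD (cvgM cvg_id (cvg_cst _)) (cvg_cst _)).
        by rewrite mul0r add0r.
      move=> P /sx xP.
      change (\forall h \near nbhs (0 : R), h != 0 -> P (h *: (1 : R) + x)).
      apply: (@filterS _ (nbhs (0 : R)) _ _ _ _ xP) => h Ph h0.
      by apply: Ph; rewrite -subr_eq0 addrK /GRing.scale /= mulr1.
    apply: cvg_trans (cvg_comp _ _ sh qx); apply: near_eq_cvg; near=> h.
    by rewrite /= addrK /GRing.scale /= mulr1.
  by apply: DeriveDef; [apply/cvg_ex; exists 0 | exact: cvg_lim].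
have cf : {within `[s, t], continuous f}.
  apply/subspace_continuousP => x xst.
  have qx := f0 x (subI _ xst).
  have ux : (u - x) @[u --> within [set` I] x^'] --> (0 : R).
    rewrite -(subrr x); apply: cvgB; last exact: cvg_cst.
    by apply: cvg_within_filter; exact: nbhs_dnbhs.
  (* Away from [x], [f u] is [f x] plus [u - x] times the quotient, and both factors tend to 0. *)
  have fx : f u @[u --> within [set` I] x^'] --> f x.
    rewrite -[X in _ --> X](add0r (f x)) -[X in X + f x](mul0r 0).
    have : (u - x) * ((u - x)^-1 * (f u - f x)) + f x
        @[u --> within [set` I] x^'] --> 0 * 0 + f x.
      by apply: cvgD; [exact: cvgM | exact: cvg_cst].
    apply: cvg_trans; apply: near_eq_cvg.
    apply: (@cvg_within _ (x^') _ [set` I]); near=> u.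
    have ux0 : u - x != 0 by rewrite subr_eq0; near: u; exact: nbhs_dnbhs_neq.
    by rewrite mulVKf // subrK.
  (* The limit [fx] ignores the point [x], whereas continuity within the segment includes it, so
     [u = x] is treated apart. *)
  move=> P Px; have fP : \forall u \near nbhs x, u != x -> u \in I -> P (f u).
    exact: fx Px.
  change (\forall u \near nbhs x, u \in `[s, t] -> P (f u)).
  apply: (@filterS _ (nbhs x) _ _ _ _ fP) => u Pu ust.
  have [->|ux0] := eqVneq u x; first exact: nbhs_singleton.
  exact: Pu ux0 (subI _ ust).
have [c _] := MVT st df cf.
by rewrite mul0r => /eqP; rewrite subr_eq0 => /eqP.
Unshelve. all: by end_near. Qed.

Theorem corollary1p8 (R : realType) (V : vectType R) (A : fluid_algebra V)
    (I : interval R) (X Z : R -> V)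
    (eulerX : euler_solution A I X)
    (transportDZ : forall t, t \in I ->
       has_derivative A I (fun s => curl A (Z s)) t
         (transport A (X t) (curl A (Z t)))) :
  forall s t, s \in I -> t \in I ->
    linking A (X s) (Z s) = linking A (X t) (Z t).
Proof.
have linkE u : linking A (X u) (Z u) = metric A (curl A (Z u)) (X u).
  by rewrite curlP hermC /= expr0 mul1r.
move=> s t sI tI; rewrite !linkE.
apply: (@within_derive0_cst R I (fun u => metric A (curl A (Z u)) (X u))) sI tI.
move=> u uI; have [v Xv vE] := eulerX _ uI.
have := has_derivative_metric _ _ _ _ _ _ _ (transportDZ _ uI) Xv.
rewrite transportP (metricC A _ v) vE triple_antisym addNr; exact.
Qed.
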